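(* Each of the 7-element sets (1) $\{0,2,4,6,8,10,12\}$ and (2) $\{0,1,2,4,5,7,11\}$ is extreme in $\mathbb Z_{16}$. They are not equivalent.
   Context: $\mathbb Z_n$ denotes the cyclic group of order $n$. For a finite abelian group $G$ with dual group $\Gamma$ and a complex measure $\mu$ on $G$: $\|\mu\|=\sum_{x\in G}|\mu(\{x\})|$, $\widehat\mu(\gamma)=\sum_{x\in G}\overline{\gamma(x)}\,\mu(\{x\})$ for $\gamma\in\Gamma$, and $\|\widehat\mu\|_\infty=\max_\gamma|\widehat\mu(\gamma)|$. A non-zero measure $\mu$ on $G$ is extreme if $\|\widehat\mu\|_\infty=\|\mu\|/\sqrt{\#\mathrm{supp}\,\mu}$. A set $E\subset G$ is extreme if it is the support of an extreme measure on $G$. Two subsets of $G$ are equivalent if one can be obtained from the other by a sequence of group automorphisms of $G$ and translations. *)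

(* Defs.v *)
From HB Require Import structures.
From Stdlib Require Import Relations.Relation_Operators.
From mathcomp Require Import all_boot all_order all_algebra.
From mathcomp Require Import complex.
From mathcomp Require Import boolp classical_sets reals.

Set Implicit Arguments.
Unset Strict Implicit.
Unset Printing Implicit Defensive.

Import Order.TTheory GRing.Theory Num.Theory.
Import ComplexField.Normc.

Local Open Scope ring_scope.
Local Open Scope complex_scope.

(* All subsets of a finite group are measurable, so a complex measure is a
   finitely additive function on {set G} ([mu set0 = 0] follows by taking
   [A = B = set0]). *)
Record complex_measure (R : realType) (G : finZmodType) := ComplexMeasure {
  measure_of :> {set G} -> R[i];
  measure_ofU : forall A B : {set G}, [disjoint A & B] ->
    measure_of (A :|: B) = measure_of A + measure_of B
}.

Section Extreme.
Variables (R : realType) (G : finZmodType).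
Implicit Types (mu : complex_measure R G) (gamma : G -> R[i]) (E : {set G}).

(* [normc] is the modulus with values in R; [`|z|] would live in R[i]. *)
Definition total_variation mu : R := \sum_(x : G) normc (mu [set x]).

Definition supp mu : {set G} := [set x | mu [set x] != 0].

Definition dual_group : set (G -> R[i]) :=
  [set gamma | (forall x, normc (gamma x) = 1) /\
               {morph gamma : x y / x + y >-> x * y}]%classic.

Definition fourier mu gamma : R[i] :=
  \sum_(x : G) conjc (gamma x) * mu [set x].

(* The dual group is finite and nonempty, so this supremum is a maximum. *)
Definition fourier_norm mu : R :=
  sup [set normc (fourier mu gamma) | gamma in dual_group]%classic.

Definition extreme_measure mu : Prop :=
  (exists A, mu A != 0) /\
  fourier_norm mu = total_variation mu / Num.sqrt #|supp mu|%:R.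

Definition extreme_set E : Prop :=
  exists mu, extreme_measure mu /\ supp mu = E.

End Extreme.

Section Equivalence.
Variable G : finZmodType.

Definition automorphic_image (E F : {set G}) : Prop :=
  exists f : {additive G -> G}, bijective f /\ F = f @: E.

Definition translate (E F : {set G}) : Prop :=
  exists a : G, F = [set x + a | x in E].

(* Both kinds of steps are invertible, so this relation is symmetric. *)
Definition equivalent_sets : {set G} -> {set G} -> Prop :=
  clos_refl_trans {set G} (union _ automorphic_image translate).

End Equivalence.

Definition set_1 : {set 'Z_16} := [set 0; 2; 4; 6; 8; 10; 12].
Definition set_2 : {set 'Z_16} := [set 0; 1; 2; 4; 5; 7; 11].

(* Main.v *)
Require Import Defs.
From mathcomp Require Import all_boot all_order all_algebra.
From mathcomp Require Import reals.
From Stdlib Require Import Relations.Relation_Operators.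
From mathcomp Require Import complex boolp classical_sets ring.

(** By Parseval, [fourier_norm mu] is at least [total_variation mu / sqrt n],
    [n] being the size of the support, with equality when both [mu] is
    unimodular on its support and its Fourier transform has constant modulus;
    the latter says that all the off-peak autocorrelations
    [\sum_x mu (x + d) * (mu x)^*], [d != 0], vanish
    ([extreme_of_perfect_autocorrelation]).

    For both sets such a measure exists with values in the cube roots of
    unity.  An autocorrelation is then a sum of cube roots of unity, and it
    vanishes as soon as each of the three occurs equally often
    ([extreme_of_balanced_differences]); this reduces extremality to counting
    differences in ['Z_16].  The exponents come from the affine plane of
    order 7.  The elements of trace 1 in the field of 49 elements form a line L
    missing the origin; L and g L meet in one point if g is outside the prime
    field, and are disjoint if g != 1 lies in it.  So L, seen in the cyclic group
    of order 48 = 16 * 3, is a 7-element set of pairs (residue, exponent) whose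
    differences outside the subgroup of order 6 occur exactly once each, and
    the others, 0 excepted, not at all.  Up to translation, its residues are
    those of the second set.  Reducing them modulo 8 and embedding ['Z_8] as the
    even residues gives, up to translation, the first set with its labels.

    Inequivalence: 8 kills every difference of two elements of the first set,
    a property stable under automorphisms and translations, whereas the second
    set contains 0 and 1. *)

Set Implicit Arguments.
Unset Strict Implicit.
Unset Printing Implicit Defensive.

Import Order.TTheory GRing.Theory Num.Theory.
Import ComplexField.Normc.

Local Open Scope ring_scope.
Local Open Scope complex_scope.

(** * Measures with perfect autocorrelation *)

Section Flat.
Variables (R : realType) (G : finZmodType).
Implicit Types (c gamma : G -> R[i]) (E : {set G}).

Lemma normc_sqr (z : R[i]) : (normc z ^+ 2)%:C = z * conjc z.
Proof. by rewrite rmorphXn /= -sqr_normc. Qed.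

Lemma normc1_conj (z : R[i]) : normc z = 1 -> z * conjc z = 1.
Proof. by move=> z1; rewrite -normc_sqr z1 expr1n. Qed.

Lemma sum_disjointU c (A B : {set G}) : [disjoint A & B] ->
  \sum_(x in A :|: B) c x = \sum_(x in A) c x + \sum_(x in B) c x.
Proof. by move=> AB; rewrite -bigU //; apply: eq_bigl => x; rewrite !inE. Qed.

Definition density_measure c : complex_measure R G :=
  ComplexMeasure (@sum_disjointU c).

Lemma density_measure1 c x : density_measure c [set x] = c x.
Proof. exact: big_set1. Qed.

Lemma fourier_density c gamma :
  fourier (density_measure c) gamma = \sum_x conjc (gamma x) * c x.
Proof. by apply: eq_bigr => x _; rewrite density_measure1. Qed.

Lemma total_variation_density c :
  total_variation (density_measure c) = \sum_x normc (c x).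
Proof. by apply: eq_bigr => x _; rewrite density_measure1. Qed.

Lemma dual_group1 : dual_group (fun _ : G => 1 : R[i]).
Proof. by split=> [x|x y]; rewrite ?mulr1 //; exact: normc1. Qed.

Lemma dual_group0 gamma : dual_group gamma -> gamma 0 = 1.
Proof.
move=> [g1 gD]; have g0 : gamma 0 != 0.
  by apply/eqP => g0; have := g1 0; rewrite g0 normc0 => /esym/eqP; rewrite oner_eq0.
by apply: (mulfI g0); rewrite -gD addr0 mulr1.
Qed.

(** Wiener-Khinchin: the squared modulus of the Fourier transform is the
    Fourier transform of the autocorrelation. *)
Lemma fourier_sqr c gamma : dual_group gamma ->
  (normc (fourier (density_measure c) gamma) ^+ 2)%:C =
  \sum_d conjc (gamma d) * \sum_x c (x + d) * conjc (c x).
Proof.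
move=> [g1 gD]; rewrite normc_sqr fourier_density rmorph_sum /= mulr_sumr.
transitivity (\sum_x \sum_d conjc (gamma d) * (c (x + d) * conjc (c x))).
  apply: eq_bigr => x _; rewrite mulr_suml.
  rewrite (reindex_inj (addrI x)) /=; apply: eq_bigr => d _.
  rewrite gD !rmorphM /= conjcK.
  have := normc1_conj (g1 x); move: (gamma x) => u u1.
  rewrite -[RHS]mulr1 -u1; ring.
by rewrite exchange_big; apply: eq_bigr => d _; rewrite mulr_sumr.
Qed.

(** Only the peak [d = 0] contributes to [fourier_sqr], so the Fourier transform
    has modulus [sqrt #|E|] at every character; the total variation is [#|E|]. *)
Lemma extreme_of_perfect_autocorrelation c E :
    (0 < #|E|)%N ->
    (forall x, x \in E -> normc (c x) = 1) ->
    (forall x, x \notin E -> c x = 0) ->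
    (forall d, d != 0 -> \sum_x c (x + d) * conjc (c x) = 0) ->
  extreme_set R E.
Proof.
move=> E0 cE c0 ac; exists (density_measure c).
have cN x : (c x != 0) = (x \in E).
  case: (boolP (x \in E)) => [xE|/c0->]; last by rewrite eqxx.
  apply/eqP => cx0; have := cE x xE.
  by rewrite cx0 normc0 => /esym/eqP; rewrite oner_eq0.
have suppE : supp (density_measure c) = E.
  by apply/setP => x; rewrite inE density_measure1 cN.
split=> //; split.
  by have /card_gt0P[x xE] := E0; exists [set x]; rewrite density_measure1 cN.
have peak : \sum_x c x * conjc (c x) = #|E|%:R.
  rewrite (bigID (mem E)) /= [X in _ + X]big1 => [|x /c0->]; last by rewrite mul0r.
  rewrite addr0 (eq_bigr (fun=> 1)) ?sumr_const // => x xE.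
  exact/normc1_conj/cE.
have flat gamma : dual_group gamma ->
    normc (fourier (density_measure c) gamma) = Num.sqrt #|E|%:R.
  move=> Hg; apply/eqP; rewrite -(@eqrXn2 _ 2) ?sqrtr_ge0 //; last first.
    by case: (fourier _ _) => a b; exact: sqrtr_ge0.
  rewrite sqr_sqrtr ?ler0n //; apply/eqP/(@complexI R).
  rewrite fourier_sqr // (bigD1 0) //= [X in _ + X]big1 => [|d d0]; last first.
    by rewrite ac ?mulr0.
  rewrite (dual_group0 Hg) conjc1 mul1r addr0 rmorph_nat -peak.
  by apply: eq_bigr => x _; rewrite addr0.
rewrite suppE.
have -> : total_variation (density_measure c) = #|E|%:R.
  rewrite total_variation_density (bigID (mem E)) /= [X in _ + X]big1; last first.
    by move=> x /c0 ->; exact: normc0.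
  rewrite addr0 (eq_bigr (fun=> 1)) ?sumr_const //.
have -> : fourier_norm (density_measure c) = Num.sqrt #|E|%:R.
  rewrite -[RHS]sup1; congr (sup _).
  apply/seteqP; split=> [_ [gamma Hg <-]|_ ->]; first exact: flat.
  by exists (fun=> 1); [exact: dual_group1 | exact/flat/dual_group1].
rewrite -{2}(sqr_sqrtr (ler0n R #|E|)) expr2 mulfK //.
by rewrite sqrtr_eq0 -ltNge ltr0n.
Qed.

(** The points [(x, e x)], [x \in E], form a set in [G * Z/p] in which every
    difference with first coordinate [d != 0] occurs as often as any other
    difference with the same first coordinate.  With [w] a [p]-th root of unity,
    the autocorrelation of [w ^+ e x] at [d] is then a multiple of
    [\sum_(t < p) w ^+ t = 0]. *)
Lemma extreme_of_balanced_differences E (e : G -> nat) p (w : R[i])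
    (k : G -> nat) :
    (0 < p)%N -> normc w = 1 -> w ^+ p = 1 -> \sum_(t < p) w ^+ t = 0 ->
    (0 < #|E|)%N ->
    (forall d (t : 'I_p), d != 0 ->
       #|[pred x | [&& x \in E, x + d \in E
                     & e (x + d) == e x + t %[mod p]]]| = k d) ->
  extreme_set R E.
Proof.
move=> p0 w1 wp sumw E0 bal.
pose c x := if x \in E then w ^+ e x else 0.
have w_conj n : w ^+ n * conjc w ^+ n = 1 by rewrite -exprMn normc1_conj // expr1n.
apply: (@extreme_of_perfect_autocorrelation c E) => // [x xE|x xE|d d0].
- rewrite /c xE; elim: (e x) => [|n IH]; first exact: normc1.
  by rewrite exprS normcM IH w1 mulr1.
- by rewrite /c (negbTE xE).
pose shift x : 'I_p := Ordinal (ltn_pmod (e (x + d)%R + p.-1 * e x) p0).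
have shiftE x (t : 'I_p) : (shift x == t) = (e (x + d) == e x + t %[mod p]).
  rewrite -val_eqE /= -{1}(modn_small (ltn_ord t)) -(eqn_modDl (e x)).
  by rewrite addnCA -mulSn prednK // addnC [(p * _)%N]mulnC modnMDl.
rewrite (bigID [pred x | (x \in E) && (x + d \in E)]) /= addrC big1 ?add0r; last first.
  by move=> x; rewrite /c negb_and => /orP[] /negbTE->; rewrite ?conjc0 ?mulr0 ?mul0r.
rewrite (partition_big shift xpredT) //=.
transitivity (\sum_(t < p) (w ^+ t) *+ k d); last by rewrite sumrMnl sumw mul0rn.
apply: eq_bigr => t _; rewrite -(bal d t d0) -sumr_const.
apply: eq_big => [x|x /andP[/andP[xE xdE]]]; first by rewrite inE shiftE -andbA.
rewrite shiftE /c xE xdE rmorphXn /= => /eqP ext.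
have -> : w ^+ e (x + d) = w ^+ (e x + t).
  by rewrite -(expr_mod _ wp) ext expr_mod.
by rewrite exprD mulrAC w_conj mul1r.
Qed.

End Flat.

(** * Cube roots of unity and difference counts in ['Z_16] *)

Section CubeRoot.
Variable R : realType.

Definition omega : R[i] := (- 2^-1) +i* (Num.sqrt 3 / 2).

Lemma omega_norm : normc omega = 1.
Proof.
rewrite /= expr_div_n sqr_sqrtr ?ler0n //.
rewrite (_ : _ + _ = 1) ?sqrtr1 //; by field.
Qed.

Lemma omega_sum : \sum_(t < 3) omega ^+ t = 0.
Proof.
rewrite !big_ord_recr big_ord0 /= add0r expr0 expr1 expr2.
apply/eqP; rewrite eq_complex /=; apply/andP; split; apply/eqP; last by field.
rewrite mulf_div -[Num.sqrt 3 * _]expr2 sqr_sqrtr ?ler0n //; by field.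
Qed.

Lemma omega_cube : omega ^+ 3 = 1.
Proof.
apply/eqP; rewrite -subr_eq0 -(expr1n _ 3) subrXX; apply/eqP.
rewrite (eq_bigr (fun t : 'I_3 => omega ^+ (2 - t))) => [|t _]; last first.
  by rewrite expr1n mulr1.
rewrite (reindex_inj rev_ord_inj) /= (eq_bigr (fun t : 'I_3 => omega ^+ t)).
  by rewrite omega_sum mulr0.
by case=> [[|[|[]]]].
Qed.

End CubeRoot.

Lemma card_Z16 (P : pred nat) : #|[pred x : 'Z_16 | P x]| = count P (iota 0 16).
Proof.
by rewrite -(val_enum_ord 16) count_map enumT cardE /enum_mem size_filter.
Qed.

(** Sets and labels are encoded by lists of naturals, on which counting
    computes; [nth 0 e x] is the label of the residue [x]. *)
Definition diff_count (s e : seq nat) (d t : nat) : nat :=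
  count (fun x => [&& x \in s, (x + d) %% 16 \in s
                    & nth 0 e ((x + d) %% 16) == nth 0 e x + t %[mod 3]])%N
    (iota 0 16).

Lemma extreme_Z16 (R : realType) (E : {set 'Z_16}) (s e : seq nat) :
    E =i [pred x : 'Z_16 | val x \in s] -> (0 < #|E|)%N ->
    all (fun d => all (fun t => diff_count s e d t == diff_count s e d 0)
                      (iota 0 3)) (iota 1 15) ->
  extreme_set R E.
Proof.
move=> Es E0 /allP bal.
apply: (@extreme_of_balanced_differences R _ E (fun x => nth 0%N e (val x)) 3
          (omega R) (fun d => diff_count s e (val d) 0)) => //.
- exact: omega_norm.
- exact: omega_cube.
- exact: omega_sum.
move=> d t d0.
have /bal/allP/(_ (val t)) : val d \in iota 1 15.
  by rewrite mem_iota lt0n ltn_ord andbT; apply: contra d0 => /eqP d0; apply/eqP/val_inj.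
rewrite mem_iota ltn_ord => /(_ isT)/eqP <-.
by rewrite /diff_count -card_Z16; apply: eq_card => x; rewrite !inE !Es !inE.
Qed.

Lemma mem_set_1 : set_1 =i [pred x : 'Z_16 | val x \in [:: 0; 2; 4; 6; 8; 10; 12]]%N.
Proof. by move=> x; rewrite !inE -!val_eqE /= -!orbA. Qed.

Lemma mem_set_2 : set_2 =i [pred x : 'Z_16 | val x \in [:: 0; 1; 2; 4; 5; 7; 11]]%N.
Proof. by move=> x; rewrite !inE -!val_eqE /= -!orbA. Qed.

Lemma card_set_1 : #|set_1| = 7%N.
Proof.
by rewrite (eq_card mem_set_1) (card_Z16 (fun n => n \in [:: 0; 2; 4; 6; 8; 10; 12]%N)).
Qed.

Lemma card_set_2 : #|set_2| = 7%N.
Proof.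
by rewrite (eq_card mem_set_2) (card_Z16 (fun n => n \in [:: 0; 1; 2; 4; 5; 7; 11]%N)).
Qed.

(** * An invariant of equivalence *)

Lemma equivalent_differences_killed (G : finZmodType) n (E F : {set G}) :
  equivalent_sets E F ->
  {in E &, forall x y, (x - y) *+ n = 0} ->
  {in F &, forall x y, (x - y) *+ n = 0}.
Proof.
elim=> {E F} [E F [[f [_ ->]]|[a ->]]|//|A B C _ IH1 _ IH2 /IH1/IH2 //] EP.
- move=> _ _ /imsetP[x xE ->] /imsetP[y yE ->].
  by rewrite -raddfB -raddfMn EP ?raddf0.
- move=> _ _ /imsetP[x xE ->] /imsetP[y yE ->].
  by rewrite opprD addrACA subrr addr0 EP.
Qed.

Theorem proposition4p12 (R : realType) :
  [/\ #|set_1| = 7%N /\ extreme_set R set_1,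
      #|set_2| = 7%N /\ extreme_set R set_2
    & ~ equivalent_sets set_1 set_2].
Proof.
split.
- split; first exact: card_set_1.
  (* Entries at residues outside the set are fillers; 12 has the default
     label 0, as has 11 in the second set. *)
  apply: (@extreme_Z16 R _ _ [:: 0; 0; 1; 0; 1; 0; 2; 0; 1; 0; 1]%N mem_set_1) => //.
  by rewrite card_set_1.
- split; first exact: card_set_2.
  apply: (@extreme_Z16 R _ _ [:: 0; 0; 1; 0; 0; 2; 0; 2]%N mem_set_2) => //.
  by rewrite card_set_2.
move=> /(@equivalent_differences_killed _ 8) killed.
have /killed /(_ 1 0) : {in set_1 &, forall x y, (x - y) *+ 8 = 0}.
  have even x : x \in set_1 -> x *+ 8 = 0.
    by rewrite !inE -!orbA; do 6?[case/orP]; move/eqP->; apply/val_inj.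
  by move=> x y /even x8 /even y8; rewrite mulrnBl x8 y8 subrr.
by rewrite !mem_set_2 => /(_ isT isT) /(congr1 val).
Qed.
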